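(* Let $G$ be a finite group with $|G|=pn$, where $p$ is the smallest prime divisor of $|G|$. Assume that $G$ contains an abelian subgroup $A$ of order $n$ (equivalently, $[G:A]=p$), and suppose that $G$ is non-abelian. Set $F:=A\cap Z(G)$ and $f:=|F|$. Then $f\le n/p$, i.e. $$\frac{|A\cap Z(G)|}{|A|}\le \frac1p .$$ Consequently, for every $r\ge 2$, $$P_r(G)\le \frac{p^r+p^{r-1}-1}{p^{2r-1}}.\qquad( * )$$ Moreover, the following are equivalent: 1. $f=n/p$ (equivalently, $n/f=p$); 2. equality holds in $( * )$ for some (equivalently, for every) $r\ge 2$; 3. $G/Z(G)\cong C_p\times C_p$; 4. $G$ has exactly $p+1$ maximal abelian subgroups containing $Z(G)$ (equivalently, these are $A$ and the $p$ distinct centralizers $C_G(x)$ with $x\in G\setminus A$).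
   Context: For a finite group $G$ and $r\ge 1$, $\mathrm{Comm}_r(G):=\{(x_1,\dots,x_r)\in G^r : x_ix_j=x_jx_i\ \text{for all } i,j\}$ and $P_r(G):=|\mathrm{Comm}_r(G)|/|G|^r$. $Z(G)$ is the center, $C_G(x)$ the centralizer of $x$ in $G$, and $C_p$ the cyclic group of order $p$. A maximal abelian subgroup is an abelian subgroup not properly contained in any other abelian subgroup. *)

(* Defs.v *)
From HB Require Import structures.
From mathcomp Require Import all_boot all_order all_algebra all_fingroup all_solvable.

Set Implicit Arguments.
Unset Strict Implicit.
Unset Printing Implicit Defensive.

Import Order.TTheory GRing.Theory Num.Theory.

Local Open Scope ring_scope.

Definition commuting_tuples (gT : finGroupType) (G : {set gT}) (r : nat) :
    {set {ffun 'I_r -> gT}} :=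
  [set x : {ffun 'I_r -> gT} | [forall i, x i \in G]
     & [forall i, forall j, (x i * x j == x j * x i)%g]].

Definition commuting_prob (gT : finGroupType) (G : {set gT}) (r : nat) : rat :=
  #|commuting_tuples G r|%:R / #|G|%:R ^+ r.

(* Only meaningful for 0 < r, where the predecessors are genuine. *)
Definition commuting_prob_bound (p r : nat) : rat :=
  (p%:R ^+ r + p%:R ^+ r.-1 - 1) / p%:R ^+ (2 * r).-1.

Definition max_abelian_over_center (gT : finGroupType) (G : {set gT}) :
    {set {group gT}} :=
  [set M : {group gT} | [max M | M \subset G & abelian M]%g
     & ('Z(G))%g \subset M].

Definition outer_centralizers (gT : finGroupType) (G A : {group gT}) :
    {set {group gT}} :=
  [set ('C_G[x])%G | x in (G :\: A)].

(* Main.v *)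
Require Import Defs.
From HB Require Import structures.
From mathcomp Require Import all_boot all_order all_algebra all_fingroup all_solvable.
From mathcomp Require Import ring.

Set Implicit Arguments.
Unset Strict Implicit.
Unset Printing Implicit Defensive.

Import Order.TTheory GRing.Theory Num.Theory.

(** Everything is governed by the index k = #|A : 'Z(G)|.

    As A is abelian of prime index and G is not abelian, 'Z(G) is a proper
    subgroup of A, so that A :&: 'Z(G) = 'Z(G), and k, a divisor of #|G| greater
    than 1, is at least p: this is the bound f <= n / p.

    Take x outside A. Then A and x generate G, so 'C_G[x] meets A in 'Z(G);
    comparing orders, with p minimal, gives #|'C_G[x] : 'Z(G)| = p
    (card_cent_outer). Hence 'C_G[x] is abelian (abelian_cent_outer), two such
    centralizers coincide or meet in 'Z(G), and the maximal abelian subgroups of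
    G are exactly A and these centralizers (max_abelian_over_centerE). A
    commuting r-tuple lies either in A ^ r or in C ^ r for exactly one outer
    centralizer C, hence with c the number of these
      |Comm_r(G)| = n ^ r + c ((p f) ^ r - f ^ r).
    For r = 1 the left side is p n, so that c = k (card_outer_centralizers).
    Dividing by (p n) ^ r, with n = f k,
      P_r(G) = (1 + (p ^ r - 1) / k ^ (r - 1)) / p ^ r
    (commuting_prob_prime_index), which for r >= 2 is strictly decreasing in k
    and equals the asserted bound at k = p.

    Each of the equivalent conditions then says k = p: f = n / p by n = f k,
    equality in the bound by strict monotonicity, the counts of maximal abelian
    subgroups by c = k, and G / 'Z(G) being C_p x C_p because this quotient has
    order p k and is never cyclic. *)

(** * Smallest prime divisors and elementary abelian groups of rank two *)

Section GroupFacts.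
Local Open Scope group_scope.

(** The index exceeds 1 and divides #|G|, so its least prime factor is at
    least p. *)
Lemma leq_index_proper_min_prime (gT : finGroupType) (G H K : {group gT}) p :
  (forall q, prime q -> q %| #|G| -> p <= q) ->
  H \subset G -> K \proper H -> p <= #|H : K|.
Proof.
move=> p_min sHG /andP[sKH not_sHK].
have i_gt1 : 1 < #|H : K| by rewrite indexg_gt1.
apply: leq_trans (p_min _ (pdiv_prime i_gt1) _) (pdiv_leq (ltnW i_gt1)).
apply: dvdn_trans (pdiv_dvd _) _.
by apply: dvdn_trans (dvdn_indexg H K) (cardSg sHG).
Qed.

(** Such a group is abelian, hence has an element whose order is its exponent;
    that order divides p ^ 2 and is not p ^ 2 itself. *)
Lemma card_p2_noncyclic_abelem (gT : finGroupType) (G : {group gT}) p :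
  prime p -> #|G| = (p ^ 2)%N -> ~~ cyclic G -> p.-abelem G.
Proof.
move=> p_pr oG ncG; have abG := card_p2group_abelian p_pr oG.
rewrite abelemE // abG /=.
have [x Gx eG] := exponent_witness (abelian_nil abG).
have := exponent_dvdn G; rewrite eG oG.
case/(dvdn_pfactor _ _ p_pr) => -[|[|[|//]]] _ ox; rewrite ox ?dvd1n //.
case/cyclicP: ncG; exists x; apply/eqP.
by rewrite eq_sym eqEcard cycle_subG Gx oG -ox /order leqnn.
Qed.

(** The right-hand group is elementary abelian of rank two, and elementary
    abelian p-groups are classified by their order. *)
Lemma isog_Zp_prod (gT : finGroupType) (G : {group gT}) p :
  prime p -> p.-abelem G ->
  (G \isog [set: 'Z_p * 'Z_p]) = (#|G| == p ^ 2)%N.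
Proof.
move=> p_pr abelG; have p_gt1 := prime_gt1 p_pr.
rewrite (isog_abelem_card [set: 'Z_p * 'Z_p] abelG) cardsT card_prod card_ord.
rewrite (Zp_cast p_gt1) mulnn eq_sym andb_idl // => _.
rewrite abelemE //; apply/andP; split.
  by apply/centsP=> -[a b] _ [c d] _; congr (_, _); apply: Zp_mulgC.
apply/exponentP=> -[a b] _.
have expE m : (a, b) ^+ m = (a ^+ m, b ^+ m).
  by elim: m => // m IHm; rewrite !expgS IHm.
rewrite expE !Zp_expg; congr (_, _); apply: val_inj;
by rewrite /= -{2}(Zp_cast p_gt1) modnMl.
Qed.

End GroupFacts.

(** * The commuting probability as a function of the index of the center *)

Section ProbOfIndex.
Local Open Scope ring_scope.

(** For r > 0 this is P_r(G) when G is non-abelian and has an abelian subgroup A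
    of index p, the smallest prime divisor of #|G|, with k = #|A : 'Z(G)|. *)
Definition prob_of_index (p k r : nat) : rat :=
  (1 + (p%:R ^+ r - 1) / k%:R ^+ r.-1) / p%:R ^+ r.

(** The bound is thus the probability in the extremal case k = p. *)
Lemma commuting_prob_boundE p r :
  (0 < p)%N -> commuting_prob_bound p r.+1 = prob_of_index p p r.+1.
Proof.
move=> p_gt0; rewrite /commuting_prob_bound /prob_of_index.
have -> : (2 * r.+1).-1 = (r.+1 + r)%N by rewrite mul2n -addnn addnS.
rewrite exprD !exprS /=.
have : p%:R != 0 :> rat by rewrite pnatr_eq0 -lt0n.
move: (p%:R : rat) => P P0; have := expf_neq0 r P0.
move: (P ^+ r) => Pr Pr0.
by field; rewrite P0 Pr0.
Qed.

(** The variable k occurs only in 1 / k ^ r.+1, which is strictly decreasing.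
    For 1-tuples the exponent of k is 0 and strictness is lost, whence the shift
    by two. *)
Lemma leif_prob_of_index p k r : (1 < p)%N -> (p <= k)%N ->
  prob_of_index p k r.+2 <= prob_of_index p p r.+2 ?= iff (k == p).
Proof.
move=> p_gt1 le_pk; have p_gt0 := ltnW p_gt1.
have le_pkr : (p ^ r.+1 <= k ^ r.+1 ?= iff (p == k))%N.
  by split; [rewrite leq_exp2r | rewrite eqn_exp2r].
have pr_gt0 : 0 < p%:R ^+ r.+2 :> rat by rewrite exprn_gt0 ?ltr0n.
have prB_gt0 : 0 < p%:R ^+ r.+2 - 1 :> rat.
  by rewrite subr_gt0 exprn_egt1 // ltr1n.
have inv_pr m : (0 < m)%N -> 0 < m%:R ^+ r.+1 :> rat.
  by move=> m_gt0; rewrite exprn_gt0 ?ltr0n.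
have k_gt0 := leq_trans p_gt0 le_pk.
split; rewrite /prob_of_index.
  rewrite ler_pM2r ?invr_gt0 // lerD2l ler_pM2l //= lef_pV2 ?posrE ?inv_pr //.
  by rewrite -!natrX ler_nat le_pkr.
rewrite (inj_eq (mulIf _)) ?invr_eq0 ?lt0r_neq0 // (inj_eq (addrI _)).
rewrite (inj_eq (mulfI _)) ?lt0r_neq0 // (inj_eq invr_inj) /= -!natrX eqr_nat.
by rewrite eq_sym le_pkr eq_sym.
Qed.

End ProbOfIndex.

(** * Non-abelian groups with an abelian subgroup of smallest prime index *)

Section AbelianPrimeIndex.
Local Open Scope group_scope.

Variables (gT : finGroupType) (G A : {group gT}) (p : nat).
Hypotheses (p_pr : prime p) (sAG : A \subset G) (abA : abelian A).
Hypotheses (iAG : #|G : A| = p) (nabG : ~~ abelian G).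
Hypothesis p_min : forall q, prime q -> q %| #|G| -> p <= q.

(** A subgroup of prime index is maximal. *)
Lemma join_prime_index (B : {group gT}) :
  B \subset G -> ~~ (B \subset A) -> A <*> B = G.
Proof.
move=> sBG; have /maxgroupP[_ maxAG] : maximal A G.
  by apply: p_index_maximal; rewrite ?iAG.
apply: contraNeq => nG; rewrite -(maxAG (A <*> B)%G) ?joing_subl ?joing_subr //.
by rewrite properEneq nG join_subG sAG.
Qed.

(** Otherwise G = A <*> 'Z(G) would be abelian. *)
Lemma center_sub_prime_index : 'Z(G) \subset A.
Proof.
apply: contraR nabG => nsZA.
rewrite -(join_prime_index (center_sub G) nsZA) abelianY abA center_abelian.
exact: subset_trans (subsetIr _ _) (centS sAG).
Qed.

(** If A were central, then G / A would have prime order, so G would be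
    abelian as a cyclic extension of a central subgroup. *)
Lemma center_proper_prime_index : 'Z(G) \proper A.
Proof.
rewrite properE center_sub_prime_index; apply: contra nabG => sAZ.
apply: (cyclic_factor_abelian sAZ); apply: prime_cyclic.
by rewrite card_quotient ?iAG // normal_norm // sub_center_normal.
Qed.

(** What commutes with both A and x commutes with A <*> <[x]> = G. *)
Lemma cent_outer x : x \in G :\: A -> 'C_A[x] = 'Z(G).
Proof.
case/setDP=> Gx notAx; have sxG : <[x]> \subset G by rewrite cycle_subG.
apply/eqP; rewrite eqEsubset -cent_cycle; apply/andP; split; last first.
  rewrite subsetI center_sub_prime_index.
  exact: subset_trans (subsetIr _ _) (centS sxG).
rewrite subsetI (subset_trans (subsetIl _ _) sAG).
rewrite -(join_prime_index sxG) ?cycle_subG // centY.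
by rewrite setSI.
Qed.

Lemma center_proper_cent_outer x :
  x \in G :\: A -> 'Z(G) \proper 'C_G[x].
Proof.
move=> GAx; have [Gx notAx] := setDP GAx.
rewrite properE -{1}(cent_outer GAx) setSI //=.
apply: contra notAx => /subsetP sCZ; apply: (subsetP center_sub_prime_index).
by apply: sCZ; rewrite inE Gx cent1id.
Qed.

(** The subgroup 'C_G[x] meets A in 'Z(G), so the product set A * 'C_G[x] has
    #|A| #|'C_G[x]| / #|'Z(G)| <= p #|A| elements, which gives the upper bound;
    the lower bound holds because #|'C_G[x] : 'Z(G)| is at least p. *)
Lemma card_cent_outer x :
  x \in G :\: A -> #|'C_G[x]| = (p * #|'Z(G)|)%N.
Proof.
move=> GAx; have /properP[sZC _] := center_proper_cent_outer GAx.
apply/eqP; rewrite eqn_leq; apply/andP; split; last first.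
  rewrite -(Lagrange sZC) mulnC leq_mul2l; apply/orP; right.
  exact: leq_index_proper_min_prime (subsetIl _ _)
                                    (center_proper_cent_outer GAx).
rewrite -(leq_pmul2l (cardG_gt0 A)) mul_cardG setIA (setIidPl sAG).
rewrite cent_outer // mulnA leq_mul2r; apply/orP; right.
rewrite -iAG Lagrange //; apply: subset_leq_card.
by rewrite mul_subG // subsetIl.
Qed.

(** The center of G has prime index in 'C_G[x], so 'C_G[x] is a cyclic
    extension of a central subgroup. *)
Lemma abelian_cent_outer x : x \in G :\: A -> abelian 'C_G[x].
Proof.
move=> GAx; have /properP[sZC _] := center_proper_cent_outer GAx.
have cZG : 'Z(G) \subset 'C(G) := subsetIr _ _.
apply: (@cyclic_factor_abelian _ 'Z(G)).
  by rewrite subsetI sZC (subset_trans cZG) // centS // subsetIl.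
apply: prime_cyclic; rewrite card_quotient.
  by rewrite -divgS // card_cent_outer // mulnK.
by apply: subset_trans (subsetIl _ _) (normal_norm (center_normal G)).
Qed.

Lemma abelian_sub_cent1 (H : {group gT}) x :
  abelian H -> H \subset G -> x \in H -> H \subset 'C_G[x].
Proof.
move=> abH sHG Hx; rewrite subsetI sHG -cent_cycle.
by apply: subset_trans abH (centS _); rewrite cycle_subG.
Qed.

(** Distinct outer centralizers are thus disjoint outside A. The reason is that
    the abelian group 'C_G[x] lies in 'C_G[y], which has the same order. *)
Lemma eq_cent_outer x y :
    x \in G :\: A -> y \in G :\: A -> y \in 'C_G[x] ->
  'C_G[x] = 'C_G[y].
Proof.
move=> GAx GAy Cy; apply/eqP; rewrite eqEcard !card_cent_outer // leqnn andbT.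
by apply: abelian_sub_cent1; rewrite ?abelian_cent_outer ?subsetIl.
Qed.

(** An abelian subgroup is either inside A or contains some x outside A, and in
    the latter case it lies in the abelian group 'C_G[x]. *)
Lemma max_abelian_over_centerE :
  max_abelian_over_center G = A |: outer_centralizers G A.
Proof.
apply/setP=> M; rewrite !inE; apply/andP/orP.
  case=> /maxgroupP[/andP[sMG abM] maxM] _.
  have [sMA | /subsetPn[x Mx notAx]] := boolP (M \subset A).
    by left; rewrite -val_eqE /= (maxM A) // sAG.
  right; have GAx : x \in G :\: A by rewrite inE notAx (subsetP sMG).
  apply/imsetP; exists x => //; apply/esym/val_inj/maxM.
    by rewrite subsetIl abelian_cent_outer.
  exact: abelian_sub_cent1.
case=> [/eqP-> | /imsetP[x GAx ->]].
  rewrite center_sub_prime_index; split=> //.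
  apply/maxgroupP; split=> [|H /andP[sHG abH] sAH]; first by rewrite sAG.
  apply/eqP; rewrite eqEsubset sAH andbT; apply: contraR nabG => nsHA.
  by rewrite -(join_prime_index sHG nsHA) (joing_idPr sAH).
split; last exact: proper_sub (center_proper_cent_outer GAx).
apply/maxgroupP; split=> [|H /andP[sHG abH] sCH].
  by rewrite subsetIl abelian_cent_outer.
apply/eqP; rewrite eqEsubset sCH andbT; apply: abelian_sub_cent1 => //.
by apply: (subsetP sCH); rewrite inE cent1id andbT; case/setDP: GAx.
Qed.

Lemma notin_outer_centralizers : A \notin outer_centralizers G A.
Proof.
apply/imsetP=> -[x /setDP[Gx /negP notAx] defA]; apply: notAx.
by rewrite defA inE Gx cent1id.
Qed.

(** * Counting commuting tuples *)

Definition tuples_in r (H : {set gT}) : {set {ffun 'I_r -> gT}} :=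
  [set t in ffun_on (mem H)].

Lemma card_tuples_in r (H : {set gT}) : #|tuples_in r H| = (#|H| ^ r)%N.
Proof. by rewrite cardsE card_ffun_on card_ord. Qed.

Lemma tuples_inP r (H : {set gT}) (t : {ffun 'I_r -> gT}) :
  reflect (forall i, t i \in H) (t \in tuples_in r H).
Proof. by rewrite inE; apply: ffun_onP. Qed.

Lemma commuting_tuplesP r (H : {set gT}) (t : {ffun 'I_r -> gT}) :
  reflect ((forall i, t i \in H) /\ forall i j, t i \in 'C[t j])
          (t \in commuting_tuples H r).
Proof.
rewrite inE; apply: (iffP andP) => -[Ht Ct]; split.
- exact/forallP.
- by move=> i j; apply/cent1P; move/forallP/(_ j)/forallP/(_ i)/eqP: Ct.
- exact/forallP.
by apply/forallP=> i; apply/forallP=> j; apply/eqP/cent1P.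
Qed.

Lemma tuples_in_abelian r (H : {group gT}) :
  abelian H -> H \subset G -> tuples_in r H \subset commuting_tuples G r.
Proof.
move=> abH sHG; apply/subsetP=> t /tuples_inP Ht; apply/commuting_tuplesP.
split=> [i | i j]; first exact: (subsetP sHG).
by have /subsetP/(_ _ (Ht i))/setIP[] := abelian_sub_cent1 abH sHG (Ht j).
Qed.

(** A commuting tuple with an entry x outside A lies in the abelian group
    'C_G[x]. Hence the tuples on the left are the disjoint union, over the outer
    centralizers C, of those in C ^ r and not in (A :&: C) ^ r = 'Z(G) ^ r. *)
Lemma card_outer_commuting_tuples r :
  #|commuting_tuples G r :\: tuples_in r A| =
    (#|outer_centralizers G A| * ((p * #|'Z(G)|) ^ r - #|'Z(G)| ^ r))%N.
Proof.
(* h recovers C from the tuple without choosing an entry outside A. *)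
pose h (t : {ffun 'I_r -> gT}) := 'C_G([set t i | i in 'I_r])%G.
have hE t i : t \in commuting_tuples G r -> t i \notin A -> h t = 'C_G[t i]%G.
  case/commuting_tuplesP=> Gt Ct notAti; apply/val_inj/eqP=> /=.
  have GAti : t i \in G :\: A by rewrite inE notAti Gt.
  have sub_t : [set t i | i in 'I_r] \subset 'C_G[t i].
    by apply/subsetP=> _ /imsetP[j _ ->]; rewrite inE Gt Ct.
  rewrite eqEsubset setIS ?subsetI ?subsetIl //=.
    exact: subset_trans (abelian_cent_outer GAti) (centS sub_t).
  by rewrite -cent_set1 centS // sub1set imset_f.
have outerP t : t \in commuting_tuples G r :\: tuples_in r A ->
    t \in commuting_tuples G r /\ exists i, t i \in G :\: A.
  case/setDP=> Ct; rewrite inE => /forallPn[i notAti]; split=> //; exists i.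
  by apply/setDP; split=> //; case/commuting_tuplesP: Ct.
rewrite -sum1_card (partition_big h (mem (outer_centralizers G A))) /=;
  last first.
  move=> t /outerP[Ct [i GAti]]; have [_ notAti] := setDP GAti.
  by rewrite (hE t i) //; apply/imsetP; exists (t i).
rewrite -sum_nat_const; apply: eq_bigr => _ /imsetP[x GAx ->].
rewrite -(card_cent_outer GAx) -(cent_outer GAx) -!card_tuples_in.
have <- : tuples_in r 'C_G[x] :&: tuples_in r A = tuples_in r 'C_A[x].
  rewrite -{2}(setIidPl sAG) -setIA; apply/setP=> t.
  apply/setIP/tuples_inP.
    by case=> /tuples_inP Ct /tuples_inP At i; rewrite inE At Ct.
  by move=> ACt; split; apply/tuples_inP=> i; case/setIP: (ACt i).
rewrite -cardsDS ?subsetIl // setDIr setDv set0U -sum1_card.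
apply: eq_bigl => t; apply/andP/setDP.
  case=> /outerP[Ct [i GAti]] /eqP.
  have [_ notAti] := setDP GAti.
  rewrite (hE t i) // => /(congr1 val)/= defC; split.
    apply/tuples_inP=> j; rewrite -defC inE.
    by case/commuting_tuplesP: Ct => -> ->.
  by apply: contra notAti => /tuples_inP.
case=> Ct notAt.
have Gt : t \in commuting_tuples G r.
  by apply: (subsetP (tuples_in_abelian r (abelian_cent_outer GAx) _)) => //;
    exact: subsetIl.
have Dt : t \in commuting_tuples G r :\: tuples_in r A by rewrite inE notAt.
split=> //; have [_ [i GAti]] := outerP t Dt.
rewrite (hE t i) //; last by case/setDP: GAti.
rewrite -val_eqE /= eq_sym; apply/eqP/eq_cent_outer => //.
by move/tuples_inP: Ct; apply.
Qed.

(** Every 1-tuple commutes, so the case r = 1 of the preceding count reads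
    #|G| - #|A| = c (p - 1) #|'Z(G)|, with c the number of outer
    centralizers. *)
Lemma card_outer_centralizers : #|outer_centralizers G A| = #|A : 'Z(G)|.
Proof.
have := card_outer_commuting_tuples 1; rewrite !expn1.
have -> : commuting_tuples G 1 = tuples_in 1 G.
  apply/setP=> t; apply/commuting_tuplesP/tuples_inP => [[] // | Gt].
  by split=> // i j; rewrite !ord1 cent1id.
rewrite cardsDS; last first.
  by apply/subsetP=> t /tuples_inP At; apply/tuples_inP=> i;
    apply: (subsetP sAG).
rewrite !card_tuples_in !expn1 -(Lagrange sAG) iAG.
rewrite -(Lagrange center_sub_prime_index).
set z := #|'Z(G)|; set k := #|A : _|; set c := #|outer_centralizers _ _|.
have p_gt1 := prime_gt1 p_pr.
rewrite mulnC -[X in (_ - X)%N]mul1n -mulnBl.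
rewrite -[X in (_ * (_ - X))%N]mul1n -mulnBl.
rewrite [(c * _)%N]mulnC -!mulnA => /eqP; rewrite eqn_pmul2l ?subn_gt0 //.
by rewrite eqn_pmul2l ?cardG_gt0 // => /eqP.
Qed.

Lemma card_commuting_tuples r :
  #|commuting_tuples G r| =
    (#|A| ^ r + #|A : 'Z(G)| * ((p * #|'Z(G)|) ^ r - #|'Z(G)| ^ r))%N.
Proof.
rewrite -card_outer_centralizers -card_outer_commuting_tuples.
by rewrite -(cardsID (tuples_in r A)) (setIidPr (tuples_in_abelian r abA sAG))
           card_tuples_in.
Qed.

Lemma commuting_prob_prime_index r :
  commuting_prob G r.+1 = prob_of_index p #|A : 'Z(G)| r.+1.
Proof.
have p_gt0 := prime_gt0 p_pr.
have le_f : (#|'Z(G)| ^ r.+1 <= (p * #|'Z(G)|) ^ r.+1)%N.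
  by rewrite leq_exp2r // leq_pmull.
rewrite /commuting_prob /prob_of_index card_commuting_tuples.
rewrite -(Lagrange sAG) iAG.
rewrite -(Lagrange center_sub_prime_index) natrD
  [(_ * (_ - _))%:R%R]natrM natrB // !natrX !natrM !exprMn !exprS.
have : (#|'Z(G)|%:R != 0 :> rat)%R by rewrite pnatr_eq0 -lt0n cardG_gt0.
have : (#|A : 'Z(G)|%:R != 0 :> rat)%R by rewrite pnatr_eq0 -lt0n indexg_gt0.
have : (p%:R != 0 :> rat)%R by rewrite pnatr_eq0 -lt0n.
move: (p%:R : rat)%R (#|_ : _|%:R : rat)%R (#|_|%:R : rat)%R => P K F P0 K0 F0.
have := expf_neq0 r P0; have := expf_neq0 r K0; have := expf_neq0 r F0.
rewrite /=.
move: (P ^+ r)%R (K ^+ r)%R (F ^+ r)%R => Pr Kr Fr Fr0 Kr0 Pr0.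
by field; rewrite P0 K0 F0 Pr0 Kr0 Fr0.
Qed.

End AbelianPrimeIndex.

(** * The bounds and the extremal case *)

Local Open Scope ring_scope.

Theorem theorem4p26 (gT : finGroupType) (G A : {group gT}) (p n : nat)
    (cardG : #|G| = (p * n)%N)
    (p_prime : prime p)
    (p_dvd : (p %| #|G|)%N)
    (p_min : forall q : nat, prime q -> (q %| #|G|)%N -> (p <= q)%N)
    (sAG : A \subset G)
    (abA : abelian A)
    (cardA : #|A| = n)
    (nabG : ~~ abelian G) :
  let F := A :&: ('Z(G))%g in
  let f := #|F| in
  [/\ (forall B : {group gT}, B \subset G -> abelian B ->
         (#|B| = n <-> #|G : B|%g = p)),
      (f%:R <= n%:R / p%:R :> rat)
        /\ (#|A :&: ('Z(G))%g|%:R / #|A|%:R <= 1 / p%:R :> rat),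
      (forall r : nat, (2 <= r)%N ->
         commuting_prob G r <= commuting_prob_bound p r)
    & [<-> f%:R = n%:R / p%:R :> rat;
           n%:R / f%:R = p%:R :> rat;
           exists2 r : nat, (2 <= r)%N &
             commuting_prob G r = commuting_prob_bound p r;
           forall r : nat, (2 <= r)%N ->
             commuting_prob G r = commuting_prob_bound p r;
           (G / 'Z(G))%g \isog [set: 'Z_p * 'Z_p];
           #|max_abelian_over_center G| = p.+1;
           max_abelian_over_center G = A |: outer_centralizers G A
             /\ #|outer_centralizers G A| = p]].
Proof.
move=> F f.
have n_gt0 : (0 < n)%N by rewrite -cardA cardG_gt0.
have p_gt0 := prime_gt0 p_prime; have p_gt1 := prime_gt1 p_prime.
have card_index (B : {group gT}) : B \subset G ->
    (#|B| = n <-> #|G : B|%g = p).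
  move=> sBG; have := Lagrange sBG; rewrite cardG => oG; split=> [oB | iB].
    by apply/eqP; rewrite -(eqn_pmul2l n_gt0) -{1}oB oG mulnC.
  by apply/eqP; rewrite -(eqn_pmul2r p_gt0) -{1}iB oG mulnC.
have iAG : #|G : A|%g = p by apply/card_index.
have sZA := center_sub_prime_index p_prime sAG abA iAG nabG.
have fE : f = #|('Z(G))%g| by rewrite /f /F (setIidPr sZA).
have f_gt0 : (0 < f)%N by rewrite fE cardG_gt0.
set k := #|A : 'Z(G)|%g.
have nE : n = (f * k)%N by rewrite -cardA fE Lagrange.
have le_pk : (p <= k)%N.
  apply: (leq_index_proper_min_prime p_min sAG).
  exact: center_proper_prime_index p_prime sAG abA iAG nabG.
have le_f : f%:R <= n%:R / p%:R :> rat.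
  by rewrite ler_pdivlMr ?ltr0n // -natrM ler_nat nE leq_mul2l le_pk orbT.
have probE r : (2 <= r)%N ->
    commuting_prob G r <= commuting_prob_bound p r ?= iff (k == p).
  case: r => [|[|r]] // _.
  rewrite commuting_prob_boundE // (commuting_prob_prime_index p_prime sAG) //.
  exact: leif_prob_of_index.
have kpF : f%:R = n%:R / p%:R :> rat <-> k = p.
  have p_neq0 : p%:R != 0 :> rat by rewrite pnatr_eq0 -lt0n.
  split=> [fnp | kp].
    apply/eqP; rewrite -(eqn_pmul2l f_gt0) -nE -(eqr_nat rat) natrM fnp.
    by rewrite divfK.
  by rewrite nE kp natrM mulfK.
have kpI : n%:R / f%:R = p%:R :> rat <-> k = p.
  rewrite nE natrM mulrC mulKf ?pnatr_eq0 -?lt0n //.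
  by split=> [/eqP|->//]; rewrite eqr_nat => /eqP.
have kpQ : (G / 'Z(G))%g \isog [set: 'Z_p * 'Z_p] <-> k = p.
  have oGZ : #|(G / 'Z(G))%g| = (p * k)%N.
    rewrite card_quotient ?normal_norm ?center_normal //.
    by rewrite -(Lagrange_index sAG sZA) iAG.
  split=> [/card_isog | kp].
    rewrite oGZ cardsT card_prod card_ord Zp_cast // => /eqP.
    by rewrite eqn_pmul2l // => /eqP.
  have oGZ2 : #|(G / 'Z(G))%g| = (p ^ 2)%N by rewrite oGZ kp mulnn.
  rewrite isog_Zp_prod ?oGZ2 //; apply: card_p2_noncyclic_abelem => //.
  by apply: contra nabG => /cyclic_center_factor_abelian.
have oO := card_outer_centralizers p_prime sAG abA iAG nabG p_min.
have maxE := max_abelian_over_centerE p_prime sAG abA iAG nabG p_min.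
have oM : #|max_abelian_over_center G| = k.+1.
  by rewrite maxE cardsU1 oO (notin_outer_centralizers G A).
split.
- by move=> B sBG _; apply: card_index.
- split=> //; rewrite -/F -/f cardA ler_pdivrMr ?ltr0n // mulrC mulrA mulr1.
  exact: le_f.
- by move=> r /probE[].
have kpP r : (2 <= r)%N ->
    commuting_prob G r = commuting_prob_bound p r <-> k = p.
  move=> /probE[_ eq_kp]; split=> [/eqP | /eqP].
    by rewrite eq_kp => /eqP.
  by rewrite -eq_kp => /eqP.
(* Each implication passes through k = p. *)
tfae.
- by move/kpF/kpI.
- by move/kpI=> kp; exists 2%N => //; apply/kpP.
- by case=> r r_ge2 /(kpP r r_ge2) kp s s_ge2; apply/kpP.
- by move/(_ 2%N isT)/kpP => /(_ isT)/kpQ.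
- by move/kpQ=> kp; rewrite oM kp.
- by rewrite oM => -[kp]; rewrite oO.
- by case=> _; rewrite oO => /kpF.
Qed.
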